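(* Let $G=(V,E)$ be a finite, connected plane graph (a graph embedded on the sphere). The following two moves define an equivalence relation on the set of edge bicolorings of $G$, two colorings being equivalent if and only if one can be obtained from the other by a finite sequence of the following two moves: (1) around a vertex, switch the colors of all edges with exactly one endpoint at that vertex (i.e. all non-loops adjacent to the vertex); (2) around a face of the embedded graph, switch the colors of all edges appearing exactly once in the boundary cycle of the face. Then the absolute value $|T_G(-1,-1)|$ of the Tutte polynomial evaluation equals the number of equivalence classes of colorings.
   Context: Graphs may have loops, multiple edges and bridges. An edge bicoloring of $G$ is an arbitrary function from $E$ to a set of two colors; switching the color of an edge replaces its color by the other one. The Tutte polynomial is $T_G(x,y)=\sum_{H\subseteq G}(x-1)^{k(H)-k(G)}(y-1)^{n(H)}$, where the sum is over all spanning subgraphs $H$ of $G$ (all vertices, any subset of edges), $k(H)$ is the number of connected components and $n(H)=e(H)-v(H)+k(H)$ is the nullity, with $e(H)$ and $v(H)$ the numbers of edges and vertices. *)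

(* Defs.v *)
From mathcomp Require Import all_boot all_fingroup all_algebra.

Set Implicit Arguments.
Unset Strict Implicit.
Unset Printing Implicit Defensive.

Import GRing.Theory.
Local Open Scope ring_scope.

(* Finite graphs with loops and multiple edges: [e] joins [endpoint e false]
   to [endpoint e true].  The orientation is only a way of naming the two ends
   of an edge, which must be told apart even when [e] is a loop. *)
Record multigraph := Multigraph {
  vertex : finType;
  edge : finType;
  endpoint : edge -> bool -> vertex
}.

Section Graph.
Variable G : multigraph.

Definition adjacent (H : {set edge G}) : rel (vertex G) :=
  [rel u v | [exists e in H, exists b : bool,
                (endpoint e b == u) && (endpoint e (~~ b) == v)]].

Definition num_components (H : {set edge G}) : nat := n_comp (adjacent H) predT.

Definition nullity (H : {set edge G}) : nat :=
  (#|H| + num_components H - #|vertex G|)%N.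

(* A spanning subgraph is identified with its edge set.  The subtractions on
   nat here and in [nullity] are never truncated, as k(G) <= k(H) and
   v(H) <= e(H) + k(H). *)
Definition tutte_poly : {poly {poly int}} :=
  \sum_(H : {set edge G})
     ('X - 1) ^+ (num_components H - num_components [set: edge G])
     * ('Y - 1) ^+ nullity H.

(* The null graph has no component, hence is not connected. *)
Definition connected : bool := num_components [set: edge G] == 1%N.

(* The dart [(e, b)] is the edge [e] traversed from [endpoint e b] to
   [endpoint e (~~ b)]. *)
Definition dart : finType := (edge G * bool)%type.

Definition dart_source (d : dart) : vertex G := endpoint d.1 d.2.

Definition dart_rev (d : dart) : dart := (d.1, ~~ d.2).

Lemma dart_revK : involutive dart_rev.
Proof. by case=> e b; rewrite /dart_rev /= negbK. Qed.

Definition rev_perm : {perm dart} := perm (inv_inj dart_revK).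

End Graph.

(* Cellular embeddings of a connected graph in an oriented closed surface, as
   rotation systems: [rotation] gives the cyclic order of the edge ends around
   each vertex. *)
Record embedding (G : multigraph) := Embedding {
  rotation : {perm dart G};
  rotation_orbitE : forall d d' : dart G,
    (d' \in porbit rotation d) = (dart_source d == dart_source d')
}.

Section EmbeddedGraph.
Variables (G : multigraph) (M : embedding G).

(* Maps [d] to [rotation M (dart_rev d)], the dart that follows [d] on the
   boundary walk of the face lying alongside [d]. *)
Definition face_perm : {perm dart G} := (rev_perm G * rotation M)%g.

(* A face is given by the darts of its boundary walk.  A connected graph
   without edges, i.e. a single vertex on the sphere, has one face, with empty
   boundary walk, which is not an orbit of darts. *)
Definition faces : {set {set dart G}} :=
  if #|edge G| == 0%N then [set set0] else porbits face_perm.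

(* For connected [G]: the surface is the sphere (Euler characteristic 2). *)
Definition planar : bool :=
  (#|vertex G| + #|faces| == #|edge G| + 2)%N.

Definition coloring : finType := {ffun edge G -> bool}.

Definition switch (S : {set edge G}) (c : coloring) : coloring :=
  [ffun e => if e \in S then ~~ c e else c e].

Definition vertex_edges (v : vertex G) : {set edge G} :=
  [set e | #|[set b : bool | endpoint e b == v]| == 1%N].

(* The number of occurrences of [e] in the boundary walk of [F] is the number
   of darts of [e] lying in [F]. *)
Definition face_edges (F : {set dart G}) : {set edge G} :=
  [set e | #|[set b : bool | (e, b) \in F]| == 1%N].

Definition move : rel coloring :=
  [rel c c' | [exists v : vertex G, c' == switch (vertex_edges v) c]
           || [exists F in faces, c' == switch (face_edges F) c]].

Definition coloring_equiv : rel coloring := connect move.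

Definition coloring_classes : {set {set coloring}} :=
  equivalence_partition coloring_equiv [set: coloring].

End EmbeddedGraph.

(* Main.v *)
(* Everything takes place over F_2.  Let D be the vertex-edge incidence matrix
   and L = D D^T.
   Colorings: the moves span the sum of the row space of D and of the span of
   the faces.  Faces are cycles, and since D has rank |V| - 1 and the faces have
   only one linear relation, Euler's formula shows that they span the cycle
   space ker D^T.  Hence there are 2^(|V| - 1 - rank L) classes.
   Tutte polynomial: 4^k(H) is the number of pairs of potentials u, w on the
   vertices whose coboundaries uD, wD vanish on H.  Exchanging the sums over H
   and over (u, w), (-2)^(|V| + 1) T(-1,-1) becomes
   sum_{u,w} prod_e (1 - 2 [(uD)_e = (wD)_e = 0]), an exponential sum of the
   quadratic form wLu^T plus linear terms.  It does not vanish because the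
   diagonal of the symmetric matrix L lies in its row space, and its absolute
   value is then 2^|V| |ker L|. *)
Require Import Defs.
From mathcomp Require Import all_boot all_fingroup all_algebra.
From mathcomp Require Import mxabelem zify.

Set Implicit Arguments.
Unset Strict Implicit.
Unset Printing Implicit Defensive.

Import GRing.Theory Num.Theory.
Local Open Scope ring_scope.

(** * Linear algebra over F_2 *)

Lemma F2P (x : 'F_2) : x = 0 \/ x = 1.
Proof. by case: x => [[|[|//]] i]; [left|right]; apply: val_inj. Qed.

Lemma addxx_F2 (x : 'F_2) : x + x = 0.
Proof. by case: (F2P x) => ->; apply: val_inj. Qed.

Lemma oppr_F2 (x : 'F_2) : - x = x.
Proof. by case: (F2P x) => ->; apply: val_inj. Qed.

Lemma addmxx_F2 m n (A : 'M['F_2]_(m, n)) : A + A = 0.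
Proof. by apply/matrixP=> i j; rewrite !mxE addxx_F2. Qed.

Lemma oppmx_F2 m n (A : 'M['F_2]_(m, n)) : - A = A.
Proof. by apply/eqP; rewrite eq_sym -addr_eq0 addmxx_F2. Qed.

Lemma addmx_eq0_F2 m n (A B : 'M['F_2]_(m, n)) : (A + B == 0) = (A == B).
Proof. by rewrite addr_eq0 oppmx_F2. Qed.

Lemma card_rowg_F2 m n (A : 'M['F_2]_(m, n)) : #|rowg A| = (2 ^ \rank A)%N.
Proof. by rewrite card_rowg card_Fp. Qed.

(** The off-diagonal terms cancel in pairs [f i j + f j i]. *)
Lemma sum_symmetric_F2 n (f : 'I_n -> 'I_n -> 'F_2) :
  (forall i j, f i j = f j i) -> \sum_i \sum_j f i j = \sum_i f i i.
Proof.
elim: n f => [|n IHn] f fC; first by rewrite !big_ord0.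
rewrite !big_ord_recl.
under [X in _ + X = _]eq_bigr => i _ do rewrite big_ord_recl.
rewrite big_split /= IHn => [|i j]; last exact: fC.
rewrite -addrA; congr (_ + _); rewrite addrA.
by under [X in _ + X + _]eq_bigr => i _ do rewrite fC; rewrite addxx_F2 add0r.
Qed.

(* If [L w = 0], then [w^T L w = 0]; over F_2 this quadratic form is the linear
   form given by the diagonal of [L]. *)
Lemma diag_sub_sym n (L : 'M['F_2]_n) : L^T = L -> (\row_i L i i <= L)%MS.
Proof.
move=> symL; rewrite submxE; apply/eqP/rowP=> k; rewrite !mxE.
set w := fun i => cokermx L i k.
have Lw0 i : \sum_j L i j * w j = 0.
  by have /matrixP/(_ i k) := mulmx_coker L; rewrite !mxE.
have LC i j : L j i = L i j by rewrite -[in LHS]symL mxE.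
have: \sum_i w i * (\sum_j L i j * w j) = 0.
  by rewrite big1 // => i _; rewrite Lw0 mulr0.
under eq_bigr => i _ do rewrite big_distrr /=.
rewrite sum_symmetric_F2 => [form0|i j]; last first.
  by rewrite LC mulrCA [RHS]mulrCA [w i * _]mulrC.
rewrite -[RHS]form0; apply: eq_bigr => i _; rewrite [in LHS]mxE mulrCA -/(w i).
by case: (F2P (w i)) => ->; rewrite ?mulr0 ?mulr1.
Qed.

(** * Exponential sums with the additive character (-1)^x of F_2 *)

Definition sgF2 (x : 'F_2) : int := if x == 0 then 1 else -1.

Lemma sgF2D x y : sgF2 (x + y) = sgF2 x * sgF2 y.
Proof. by case: (F2P x) => ->; case: (F2P y) => ->. Qed.

Lemma sgF2_sum (I : finType) (f : I -> 'F_2) :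
  sgF2 (\sum_i f i) = \prod_i sgF2 (f i).
Proof. exact: (big_morph sgF2 sgF2D). Qed.

Lemma normr_sgF2 x : `|sgF2 x| = 1.
Proof. by rewrite /sgF2; case: eqP => _; rewrite ?normrN normr1. Qed.

Lemma sum_sgF2 n (z : 'cV['F_2]_n) :
  \sum_(w : 'rV_n) sgF2 ((w *m z) 0 0) = if z == 0 then 2 ^+ n else 0.
Proof.
case: eqP => [-> | /eqP nz].
  under eq_bigr => w _ do rewrite mulmx0 mxE.
  by rewrite sumr_const card_mx card_Fp // mul1n -natrX.
have [i zi]: exists i, z i 0 != 0.
  apply/existsP; apply: contraR nz; rewrite negb_exists => /forallP zi.
  by apply/eqP/colP=> i; rewrite mxE; apply/eqP; rewrite -[_ == _]negbK.
(* Translating [w] by the basis vector at a nonzero entry of [z] changes the sign of every term. *)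
set S := (X in X = _); have: S = - S.
  rewrite {1}/S (reindex_inj (addrI (delta_mx 0 i))) -sumrN.
  apply: eq_bigr => w _.
  rewrite mulmxDl [fun_of_matrix (_ + _) _ _]mxE sgF2D -rowE mxE.
  by case: (F2P (z i 0)) zi => ->; rewrite ?eqxx // mulN1r.
by move/eqP; rewrite -addr_eq0 -mulr2n mulrn_eq0 /= => /eqP.
Qed.

(* Over F_2, [1 - 2 [a = b = 0] = - (-1)^(a + b + a b)], so that the sum is an
   exponential sum of a quadratic form, linear in each argument. *)
Lemma normr_sum_common_zeros m n (D : 'M['F_2]_(m, n)) :
  `|\sum_(u : 'rV['F_2]_m) \sum_(w : 'rV['F_2]_m)
      \prod_j (1 + (if ((u *m D) 0 j == 0) && ((w *m D) 0 j == 0)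
                     then -2 else 0))|
  = 2 ^+ (m + (m - \rank (D *m D^T))) :> int.
Proof.
set L := D *m D^T; set d := D *m const_mx 1 : 'cV_m.
have symL : L^T = L by rewrite trmx_mul trmxK.
have dE : d^T = \row_i L i i.
  apply/rowP=> i; rewrite !mxE; apply: eq_bigr => j _; rewrite !mxE mulr1.
  by case: (F2P (D i j)) => ->; rewrite ?mulr0 ?mulr1.
(* The inner sum over [w] vanishes unless [d + L u^T = 0]; a solution [u0] exists, and the others
   differ from it by the kernel of [L]. *)
have /submxP[u0 u0L] : (d^T <= L)%MS by rewrite dE diag_sub_sym.
have prodE (u w : 'rV['F_2]_m) :
    \prod_j (1 + (if ((u *m D) 0 j == 0) && ((w *m D) 0 j == 0) then -2 else 0))
    = (-1) ^+ n * (sgF2 ((u *m d) 0 0) * sgF2 ((w *m (d + L *m u^T)) 0 0)).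
  rewrite mulmxDr [fun_of_matrix (_ + _) _ _]mxE -sgF2D.
  pose a := u *m D; pose b := w *m D.
  have -> : w *m (L *m u^T) = b *m a^T by rewrite /a /b trmx_mul !mulmxA.
  rewrite !mulmxA -/a -/b; clearbody a b.
  rewrite ![fun_of_matrix (_ *m _) _ _]mxE -!big_split sgF2_sum /=.
  rewrite -[in (-1) ^+ n](card_ord n) -prodr_const -big_split /=.
  apply: eq_bigr => j _; rewrite !mxE !mulr1.
  by case: (F2P (a 0 j)) => ->; case: (F2P (b 0 j)) => ->.
under eq_bigr => u _ do
  (under eq_bigr => w _ do rewrite prodE; rewrite -!big_distrr /= sum_sgF2).
rewrite -big_distrr /= normrM normrX normrN1 expr1n mul1r.
have dL (u : 'rV_m) : (d + L *m u^T == 0) = (u - u0 <= kermx L)%MS.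
  rewrite addmx_eq0_F2 -(inj_eq trmx_inj) [(L *m _)^T]trmx_mul trmxK.
  rewrite symL u0L -subr_eq0.
  rewrite -mulmxBl -[u0 - u]oppmx_F2 opprB.
  exact: (sameP eqP sub_kermxP).
under eq_bigr => u _ do rewrite dL.
rewrite (reindex_inj (addIr u0)) /=.
(* For [v L = 0] also [v d = v L u0^T = 0], so all surviving terms carry the sign of [u0 d] and none
   cancel. *)
rewrite (eq_bigr (fun v : 'rV_m => if v \in rowg (kermx L) then
  sgF2 ((u0 *m d) 0 0) * 2 ^+ m else 0)) => [|v _]; last first.
  rewrite addrK mem_rowg; case: ifP => [/sub_kermxP vL | _]; last exact: mulr0.
  congr (_ * _); rewrite mulmxDl [fun_of_matrix (_ + _) _ _]mxE sgF2D.
  rewrite [sgF2 _](_ : _ = 1) ?mul1r //.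
  have -> : d = L *m u0^T by rewrite -[d]trmxK u0L trmx_mul symL.
  by rewrite mulmxA vL mul0mx mxE.
rewrite -big_mkcond sumr_const card_rowg_F2 mxrank_ker normrMn normrM.
rewrite normr_sgF2.
by rewrite mul1r ger0_norm ?exprn_ge0 // -[_ *+ (2 ^ _)]mulr_natr natrX exprD.
Qed.

(** * Incidence matrix, components and the Tutte polynomial *)

Section Incidence.
Variable G : multigraph.

(** Both ends of a loop fall on one vertex and cancel mod 2, in accordance with [vertex_edges]. *)
Definition incidence : 'M['F_2]_(#|vertex G|, #|edge G|) :=
  \matrix_(i, j) \sum_b (endpoint (enum_val j) b == enum_val i)%:R.

Lemma mul_incidence (u : 'rV_#|vertex G|) e :
  (u *m incidence) 0 (enum_rank e) =
  u 0 (enum_rank (endpoint e true)) + u 0 (enum_rank (endpoint e false)).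
Proof.
rewrite mxE; under eq_bigr => i _ do rewrite mxE big_distrr /= enum_rankK.
rewrite exchange_big big_bool /=.
have entry b : \sum_i u 0 i * (endpoint e b == enum_val i)%:R =
    u 0 (enum_rank (endpoint e b)).
  rewrite (bigD1 (enum_rank (endpoint e b))) //= enum_rankK eqxx mulr1.
  rewrite big1 ?addr0 //.
  move=> i ne; case: eqP => [eq_i|]; last by rewrite mulr0.
  by rewrite eq_i enum_valK eqxx in ne.
by rewrite !entry.
Qed.

Lemma adjacent_sym (H : {set edge G}) : symmetric (adjacent H).
Proof.
suff sub u v : adjacent H u v -> adjacent H v u.
  by move=> u v; apply/idP/idP; apply: sub.
case/exists_inP=> e eH /existsP[b /andP[ebu ebv]].
apply/exists_inP; exists e => //; apply/existsP; exists (~~ b).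
by rewrite negbK ebv.
Qed.

(** The cohomology group H^0 of the spanning subgraph [H] over F_2. *)
Definition flat_potentials (H : {set edge G}) : {set 'rV['F_2]_#|vertex G|} :=
  [set u | [forall e in H, (u *m incidence) 0 (enum_rank e) == 0]].

Lemma flat_potentials_connect H u : u \in flat_potentials H ->
  forall v w, connect (adjacent H) v w -> u 0 (enum_rank v) = u 0 (enum_rank w).
Proof.
rewrite inE => /forall_inP uH v w vw.
have clos :
    closed (adjacent H) [pred x | u 0 (enum_rank x) == u 0 (enum_rank v)].
  apply: (intro_closed (sym_connect_sym (@adjacent_sym H))) => x y.
  case/exists_inP=> e eH /existsP[b /andP[/eqP<- /eqP<-]].
  rewrite !inE => /eqP <-.
  have := uH e eH; rewrite mul_incidence addr_eq0 => /eqP ue; apply/eqP.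
  by case: b; rewrite /= ue oppr_F2.
have := closed_connect clos vw; rewrite !inE eqxx => /esym/eqP ->.
by [].
Qed.

(** A flat potential amounts to a free choice of one value at the canonical root of each
    component. *)
Lemma card_flat_potentials H : #|flat_potentials H| = (2 ^ num_components H)%N.
Proof.
pose e := adjacent H.
have eC : connect_sym e := sym_connect_sym (@adjacent_sym H).
pose comp v : {v | roots e v} := Sub (fingraph.root e v) (roots_root eC v).
pose lift_comp (g : {ffun {v | roots e v} -> 'F_2}) : 'rV_#|vertex G| :=
  \row_i g (comp (enum_val i)).
have -> : flat_potentials H = lift_comp @: setT.
  apply/setP=> u; apply/idP/imsetP => [uH | [g _ ->]].
    exists [ffun x => u 0 (enum_rank (val x))] => //.
    apply/rowP=> i; rewrite mxE ffunE /= -{1}[i]enum_valK.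
    exact: (flat_potentials_connect uH (connect_root _ _)).
  rewrite inE; apply/forall_inP=> a aH; rewrite mul_incidence !mxE !enum_rankK.
  suff -> : comp (endpoint a true) = comp (endpoint a false).
    by rewrite addxx_F2.
  apply/val_inj/(fingraph.rootP eC)/connect1/exists_inP; exists a => //.
  by apply/existsP; exists true; rewrite !eqxx.
rewrite card_imset; last first.
  move=> g h /rowP gh; apply/ffunP=> x; have := gh (enum_rank (val x)).
  rewrite !mxE enum_rankK; suff -> : comp (val x) = x by [].
  by apply: val_inj; rewrite /=; apply/eqP; case: x.
rewrite cardsT card_ffun card_Fp // card_sig; congr (2 ^ _)%N.
by apply: eq_card => v; rewrite !inE andbT.
Qed.

(** The flat potentials of [H] form the left kernel of the columns of [incidence] indexed by [H];
    its cardinality gives the rank. *)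
Lemma num_components_rank H :
  #|vertex G| = (num_components H +
    \rank (colsub (fun i : 'I_#|H| => enum_rank (enum_val i)) incidence))%N.
Proof.
set B := colsub _ _; rewrite -[LHS](subnK (rank_leq_row B)); congr (_ + _)%N.
apply: (@expnI 2) => //; rewrite -card_flat_potentials -mxrank_ker.
rewrite -card_rowg_F2.
apply: eq_card => u; rewrite mem_rowg [RHS]inE.
apply/sub_kermxP/forall_inP => [uB e eH|uH].
  move/rowP/(_ (enum_rank_in eH e)): uB; rewrite mulmx_colsub [LHS]mxE [RHS]mxE.
  by rewrite enum_rankK_in // => ->.
apply/rowP=> i; rewrite mulmx_colsub [LHS]mxE [RHS]mxE.
by apply/eqP/uH/enum_valP.
Qed.

Lemma leq_vertices_components (H : {set edge G}) :
  (#|vertex G| <= #|H| + num_components H)%N.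
Proof. by rewrite (num_components_rank H) addnC leq_add2r rank_leq_col. Qed.

(** A potential that is flat on all edges is flat on [H]. *)
Lemma leq_components (H : {set edge G}) :
  (num_components [set: edge G] <= num_components H)%N.
Proof.
rewrite -(@leq_exp2l 2) // -!card_flat_potentials.
apply/subset_leq_card/subsetP => u.
rewrite !inE => /forall_inP uT; apply/forall_inP=> e _.
by apply: uT; rewrite inE.
Qed.

Lemma rank_incidence : connected G -> #|vertex G| = (\rank incidence).+1.
Proof.
move=> /eqP kG; have := card_flat_potentials setT; rewrite kG.
have -> : flat_potentials setT = rowg (kermx incidence).
  apply/setP=> u; rewrite mem_rowg inE.
  apply/forall_inP/sub_kermxP => [uT|uD e _].
    apply/rowP=> j; rewrite [RHS]mxE -[j]enum_valK; apply/eqP/uT.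
    exact: in_setT.
  by rewrite uD mxE.
rewrite card_rowg_F2 mxrank_ker => /(@expnI 2 isT) k1.
by rewrite -[LHS](subnK (rank_leq_row incidence)) k1.
Qed.

Lemma normr_tutte : connected G ->
  `|(tutte_poly G).[-1, -1]| * 2 =
  2 ^+ (#|vertex G| - \rank (incidence *m incidence^T)) :> int.
Proof.
move=> Gc; have kG : num_components [set: edge G] = 1 by apply/eqP.
set r := (_ - _)%N; set N := #|vertex G|.
have pow2 : 2 ^+ N != 0 :> int by rewrite expf_neq0.
suff main : (-2) ^+ N.+1 * (tutte_poly G).[-1, -1] =
    \sum_(u : 'rV['F_2]_N) \sum_(w : 'rV['F_2]_N) \prod_j
      (1 + (if ((u *m incidence) 0 j == 0) && ((w *m incidence) 0 j == 0)
            then -2 else 0)).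
  apply: (mulfI pow2); rewrite -exprD -normr_sum_common_zeros -main.
  by rewrite normrM normrX normrN normr_nat exprSr -[RHS]mulrA [2 * _]mulrC.
(* With k = k(H), the exponents of -2 add up to (|V| + 1) + (k - 1) + (|H| + k - |V|) = |H| + 2k,
   and (-2)^(2k) is the square of the number of flat potentials. *)
transitivity (\sum_(H : {set edge G})
    (-2) ^+ #|H| * (#|flat_potentials H| ^ 2)%:R : int).
  rewrite /tutte_poly !horner_sum mulr_sumr; apply: eq_bigr => H _.
  rewrite card_flat_potentials !hornerE.
  have k0 : (0 < num_components H)%N.
    by rewrite (leq_trans _ (leq_components H)) ?kG.
  rewrite /= [-1 - 1](_ : _ = -2) // kG /nullity -!exprD.
  rewrite natrX natrX -exprM mulnC exprM -sqrrN -exprM -exprD.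
  congr (_ ^+ _); have := leq_vertices_components H; rewrite -/N.
  by move: k0; case: (num_components H) => // k _; rewrite subn1 /=; lia.
have sqE (H : {set edge G}) : (#|flat_potentials H| ^ 2)%:R =
    \sum_(u : 'rV['F_2]_N) \sum_(w : 'rV['F_2]_N)
      ((u \in flat_potentials H) && (w \in flat_potentials H))%:R :> int.
  rewrite -mulnn natrM -!sum1_card !natr_sum big_distrl big_mkcond /=.
  apply: eq_bigr => u _; rewrite mul1r. 
  case: ifP => _ /=; last by rewrite big1.
  by rewrite big_mkcond; apply: eq_bigr => w _; case: (w \in _).
under eq_bigr => H _ do rewrite sqE big_distrr /=.
rewrite exchange_big; apply: eq_bigr => u _.
under eq_bigr => H _ do rewrite big_distrr /=.
rewrite exchange_big; apply: eq_bigr => w _ /=.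
rewrite (reindex (@enum_rank (edge G))) /=; last exact/onW_bij/enum_rank_bij.
(* When the product over edges is expanded, [H] is the set of edges where the summand other than 1
   is chosen; the term is nonzero only if both potentials are flat on [H]. *)
under [RHS]eq_bigr => e _ do rewrite addrC.
rewrite bigA_distr; apply: eq_bigr => H _.
rewrite -big_mkcond /=; case: (boolP (_ && _)) => [/andP[uH wH] | uwH].
  rewrite mulr1 -prodr_const; apply: eq_bigr => e eH.
  move: uH wH; rewrite !inE => /forall_inP/(_ e eH) ->.
  by move=> /forall_inP/(_ e eH) ->.
rewrite mulr0; suff [e eH /negPf ne] : exists2 e, e \in H &
    ~~ (((u *m incidence) 0 (enum_rank e) == 0) &&
        ((w *m incidence) 0 (enum_rank e) == 0)).
  by rewrite (bigD1 e) //= ne mul0r.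
apply/exists_inP; apply: contraR uwH; rewrite negb_exists_in => /forall_inP uw0.
rewrite !inE; apply/andP; split; apply/forall_inP=> e /uw0;
  by rewrite negbK => /andP[].
Qed.

End Incidence.

(** * Faces and the cycle space *)

Section Faces.
Variables (G : multigraph) (M : embedding G).

(** An edge traversed twice by the same boundary walk contributes 0 mod 2, in accordance with
    [face_edges]. *)
Definition face_incidence : 'M['F_2]_(#|faces M|, #|edge G|) :=
  \matrix_(i, j) \sum_b ((enum_val j, b) \in (enum_val i : {set dart G}))%:R.

Lemma source_rotation (d : dart G) : dart_source (rotation M d) = dart_source d.
Proof.
apply/esym/eqP; rewrite -(rotation_orbitE M).
by have := mem_porbit (rotation M) 1 d; rewrite expg1.
Qed.

Lemma face_permE d : face_perm M d = rotation M (dart_rev d).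
Proof. by rewrite permM permE. Qed.

Lemma mem_face_perm (F : {set dart G}) d :
  F \in faces M -> (face_perm M d \in F) = (d \in F).
Proof.
rewrite /faces; case: ifP => [/eqP/card0_eq E0 _ | _ /imsetP[x _ ->]].
  by case: d => e b; have := E0 e.
rewrite -!eq_porbit_mem.
by have := porbit_perm (face_perm M) 1 d; rewrite expg1 => ->.
Qed.

(* Each visit of a boundary walk to a vertex uses two darts. *)
Lemma face_incidence_boundary : face_incidence *m (incidence G)^T = 0.
Proof.
apply/matrixP=> i k; rewrite !mxE; set v := enum_val k.
have /= := enum_valP i; set F := enum_val i => FM.
pose at_v (d : dart G) : 'F_2 := (dart_source d == v)%:R.
rewrite (eq_bigr (fun j => \sum_b (((enum_val j, b) \in F)%:R *
    (at_v (enum_val j, b) + at_v (dart_rev (enum_val j, b)))))); last first.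
  move=> j _; rewrite !mxE -/F -/v !big_bool /= /at_v /dart_rev /dart_source /=.
  by rewrite mulrDl; congr (_ + _ * _); rewrite addrC.
rewrite (reindex (@enum_rank (edge G))) /=; last exact/onW_bij/enum_rank_bij.
under eq_bigr => e _ do rewrite enum_rankK.
rewrite pair_big /= (eq_bigr (fun d : dart G =>
  (d \in F)%:R * at_v d + (d \in F)%:R * at_v (dart_rev d))); last first.
  by move=> [e b] _; rewrite mulrDr.
(* One step along the boundary walk turns the sum over sources into the sum over targets. *)
rewrite big_split /= (reindex_inj (@perm_inj _ (face_perm M))) /=.
apply: etrans (addxx_F2 (\sum_d (d \in F)%:R * at_v (dart_rev d))).
congr (_ + _); apply: eq_bigr => d _.
by rewrite mem_face_perm // /at_v face_permE source_rotation.
Qed.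

(** Plays the role of connectedness of the dual graph. Invariance under reversal and [face_perm]
    gives invariance under [rotation], so [g] depends on the source only; reversal then carries its
    value to adjacent vertices. *)
Lemma constant_on_darts (T : eqType) (g : dart G -> T) : connected G ->
  (forall d, g (dart_rev d) = g d) -> (forall d, g (face_perm M d) = g d) ->
  forall d d', g d = g d'.
Proof.
move=> Gc g_rev g_face.
have g_rot d : g (rotation M d) = g d.
  by rewrite -[in LHS](dart_revK d) -face_permE g_face g_rev.
have g_source d d' : dart_source d = dart_source d' -> g d = g d'.
  move/eqP; rewrite -(rotation_orbitE M) => /porbitP[n ->].
  by elim: n => [|n IHn]; rewrite ?perm1 // expgSr permM g_rot.
have adjC := sym_connect_sym (@adjacent_sym G setT).
move=> d d'.
pose a := [pred v | [forall x : dart G, (dart_source x == v) ==> (g x == g d)]].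
have clos : closed (adjacent [set: edge G]) a.
  apply: (intro_closed adjC) => x y.
  case/exists_inP=> e _ /existsP[b /andP[/eqP ex /eqP ey]].
  move=> /forallP/(_ (e, b)); rewrite /dart_source /= ex eqxx => /eqP gx.
  apply/forallP=> z; apply/implyP=> /eqP zy; rewrite -gx -(g_rev (e, b)).
  by apply/eqP/g_source; rewrite zy.
have conn : connect (adjacent [set: edge G]) (dart_source d) (dart_source d').
  have k1 : #|predI (roots (adjacent [set: edge G])) predT| = 1%N by apply/eqP.
  apply/(fingraph.rootP adjC).
  have /card_le1_eqP := eq_leq k1; apply; by rewrite inE /= roots_root.
have : dart_source d' \in a.
  rewrite -(closed_connect clos conn).
  by apply/forallP=> x; apply/implyP=> /eqP xd; apply/eqP/g_source.
by move=> /forallP/(_ d'); rewrite eqxx => /eqP ->.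
Qed.

(* A sum of faces vanishes only if it is empty or the sum of all faces. *)
Lemma rank_face_incidence : connected G ->
  (#|faces M| <= (\rank face_incidence).+1)%N.
Proof.
move=> Gc; rewrite -addn1 -leq_subLR -mxrank_ker.
suff /mxrankS : (kermx face_incidence <= (const_mx 1 : 'rV_#|faces M|))%MS.
  move/leq_trans; apply; exact: rank_leq_row.
apply/rV_subP => u /sub_kermxP uF.
suff u_const i j : u 0 i = u 0 j.
  case: (pickP 'I_#|faces M|) => [i _ | no_face].
    apply/submxP; exists (u 0 i)%:M; rewrite mul_scalar_mx.
    by apply/rowP=> j; rewrite !mxE mulr1.
  suff -> : u = 0 by apply: sub0mx.
  by apply/rowP=> i; have := no_face i.
(* Without edges the only face is [set0]; it contains no dart from which its coefficient could be
   read. *)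
case: (posnP #|edge G|) => [E0 | E_gt0].
  have f1 : #|faces M| = 1%N by rewrite /faces E0 eqxx cards1.
  congr (u 0 _); apply: val_inj; case: i j => [i +] [j +] /=.
  by rewrite f1; case: i j => [|i] [|j].
pose face i : {set dart G} := enum_val (i : 'I_#|faces M|).
(* [g] is the coefficient of the face containing a dart. As [u] is a relation between faces, the
   coefficients on the two sides of an edge agree. *)
pose g d := \sum_i u 0 i * (d \in face i)%:R.
have g_const : forall d d', g d = g d'.
  apply: constant_on_darts => //.
    move=> [e b]; apply/eqP; rewrite -subr_eq0.
      have := congr1 (fun A : 'rV_ _ => A 0 (enum_rank e)) uF.
    rewrite [RHS]mxE => <-.
    rewrite oppr_F2 mxE -big_split /=; apply/eqP/eq_bigr=> k _.
    rewrite mxE enum_rankK big_bool -mulrDr -/(face k) /dart_rev.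
    by case: b => //=; rewrite addrC.
  by move=> d; apply: eq_bigr => k _; rewrite mem_face_perm ?enum_valP.
have g_face d k : d \in face k -> g d = u 0 k.
  move=> dk; rewrite /g (bigD1 k) //= dk mulr1 big1 ?addr0 // => l ne_lk.
  case: (boolP (d \in face l)) => [dl|]; last by rewrite mulr0.
  case/eqP: ne_lk; apply: enum_val_inj; rewrite -/(face k) -/(face l).
  have orbitE h : d \in face h -> face h = porbit (face_perm M) d.
    have := enum_valP h; rewrite -/(face h) {1}/faces gtn_eqF //.
    case/imsetP=> x _ ->; by rewrite -eq_porbit_mem => /eqP.
  by rewrite (orbitE l dl) (orbitE k dk).
have nonempty k : exists d, d \in face k.
  have := enum_valP k; rewrite -/(face k) {1}/faces gtn_eqF //.
  by case/imsetP=> x _ ->; exists x; exact: porbit_id.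
have [[d di] [d' dj]] := (nonempty i, nonempty j).
by rewrite -(g_face d) // -(g_face d').
Qed.

(** Faces are cycles, and their rank is at least |F| - 1 = |E| - (|V| - 1) by Euler's formula, which
    is the dimension of the cycle space. *)
Lemma face_incidence_ker : connected G -> planar M ->
  (face_incidence :=: kermx (incidence G)^T)%MS.
Proof.
move=> Gc /eqP euler.
have sub : (face_incidence <= kermx (incidence G)^T)%MS.
  by apply/sub_kermxP/face_incidence_boundary.
apply/eqmxP; rewrite sub /= -(geq_leqif (mxrank_leqif_sup sub)).
rewrite mxrank_ker mxrank_tr.
have := rank_face_incidence Gc; have := rank_incidence Gc; lia.
Qed.

(** The row space of [D] and the cycle space [kermx D^T] meet in the bicycle space, of dimension
    rank D - rank(D D^T). *)
Lemma rank_incidence_faces : connected G -> planar M ->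
  \rank (incidence G + face_incidence)%MS =
  (#|edge G| - \rank (incidence G) + \rank (incidence G *m (incidence G)^T))%N.
Proof.
move=> Gc Mp; set D := incidence G.
have faceK := face_incidence_ker Gc Mp.
rewrite (adds_eqmx (eqmx_refl D) faceK) -/D.
have := mxrank_sum_cap D (kermx D^T); have := mxrank_mul_ker D D^T.
rewrite mxrank_ker mxrank_tr => {1}<- /eqP.
by rewrite addnAC eqn_add2r addnC => /eqP->.
Qed.

(** * Colorings as vectors, and the number of classes *)

Definition coloring_vec (c : coloring G) : 'rV['F_2]_#|edge G| :=
  \row_j (c (enum_val j))%:R.

Lemma coloring_vec_bij : bijective coloring_vec.
Proof.
exists (fun x : 'rV_#|edge G| => [ffun e => x 0 (enum_rank e) == 1]) => [c | x].
  by apply/ffunP=> e; rewrite ffunE mxE enum_rankK; case: (c e).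
apply/rowP=> j; rewrite mxE ffunE enum_valK.
by case: (F2P (x 0 j)) => ->.
Qed.

(** Serves vertices and faces alike: of the two ends of an edge, exactly one satisfies [P] iff their
    number is odd. *)
Lemma coloring_vec_switch (P : edge G -> bool -> bool) c :
  coloring_vec (switch [set e | #|[set b | P e b]| == 1] c) =
  coloring_vec c + \row_j \sum_b (P (enum_val j) b)%:R.
Proof.
apply/rowP=> j; rewrite !mxE ffunE inE big_bool /=.
rewrite -sum1dep_card big_mkcond big_bool /=.
by case: (c _); case: (P _ true); case: (P _ false); apply: val_inj.
Qed.

Lemma moveP c c' : reflect
  ((exists i, coloring_vec c' = coloring_vec c + row i (incidence G)) \/
   (exists i, coloring_vec c' = coloring_vec c + row i face_incidence))
  (move M c c').
Proof.
have vecI := bij_inj coloring_vec_bij.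
have vertexE v : coloring_vec (switch (vertex_edges v) c) =
    coloring_vec c + row (enum_rank v) (incidence G).
  rewrite coloring_vec_switch; congr (_ + _); apply/rowP=> j; rewrite !mxE.
  by rewrite enum_rankK.
have faceE i : coloring_vec (switch (face_edges (enum_val i)) c) =
    coloring_vec c + row i face_incidence.
  by rewrite coloring_vec_switch; congr (_ + _); apply/rowP=> j; rewrite !mxE.
apply: (iffP orP) =>
  [[/existsP[v /eqP->] | /exists_inP[F FM /eqP->]] | [[i] | [i]]].
- by left; exists (enum_rank v).
- by right; exists (enum_rank_in FM F); rewrite -faceE enum_rankK_in.
- rewrite -[i]enum_valK -vertexE => /vecI->; left; apply/existsP.
  by exists (enum_val i).
rewrite -faceE => /vecI->; right; apply/exists_inP.
by exists (enum_val i); rewrite ?enum_valP.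
Qed.

Lemma coloring_equivE c c' :
  coloring_equiv M c c' =
  (coloring_vec c' - coloring_vec c <= incidence G + face_incidence)%MS.
Proof.
have [uncolor vecK uncolorK] := coloring_vec_bij.
apply/idP/idP => [/connectP[p] | ].
  elim: p c => [|x p IHp] c /=; first by move=> _ ->; rewrite subrr sub0mx.
  case/andP=> /moveP cx xp /(IHp _ xp) xc'.
  rewrite -(subrK (coloring_vec x) (coloring_vec c')) -addrA addmx_sub //.
  by case: cx => [[i ->] | [i ->]]; rewrite addrAC subrr add0r;
    apply: submx_trans (row_sub _ _) _; rewrite (addsmxSl, addsmxSr).
(* The rows with coefficient 1 are added one at a time, each by one move. *)
have steps m (A : 'M['F_2]_(m, #|edge G|)) :
    (forall x y i, coloring_vec y = coloring_vec x + row i A -> move M x y) ->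
  forall (w : 'rV_m) x y, coloring_vec y = coloring_vec x + w *m A ->
  coloring_equiv M x y.
  move=> A_move w x y; rewrite mulmx_sum_row.
  elim: (index_enum _) y => [|i r IHr] y.
    by rewrite big_nil addr0 => /(can_inj vecK) ->; exact: connect0.
  rewrite big_cons [_ *: _ + _]addrC addrA => yE.
  pose z := uncolor (coloring_vec x + \sum_(j <- r) w 0 j *: row j A).
  apply: (connect_trans (IHr z _)); rewrite {}/z.
    by rewrite uncolorK.
  case: (F2P (w 0 i)) yE => ->; rewrite ?scale0r ?scale1r ?addr0 => yE.
    by rewrite -yE vecK; exact: connect0.
  by apply/connect1/(A_move _ _ i); rewrite uncolorK.
case/sub_addsmxP=> [[w1 w2] /= c'E].
(* All vertex moves are made first, then all face moves. *)
apply: (connect_trans (y := uncolor (coloring_vec c + w1 *m incidence G))).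
  apply: (steps _ _ _ w1); last by rewrite uncolorK.
  by move=> x y i xy; apply/moveP; left; exists i.
apply: (steps _ face_incidence _ w2); last first.
  by rewrite uncolorK -addrA -c'E addrC subrK.
by move=> x y i xy; apply/moveP; right; exists i.
Qed.

Lemma coloring_equiv_rel : equivalence_rel (coloring_equiv M).
Proof.
move=> x y z; split=> [|xy]; first exact: connect0.
have sym a b : coloring_equiv M a b -> coloring_equiv M b a.
  by rewrite !coloring_equivE -[coloring_vec b - coloring_vec a]oppmx_F2 opprB.
by apply/idP/idP; apply: connect_trans => //; apply: sym.
Qed.

(** Each class is a translate of the span of the moves, so all have the same size. *)
Lemma card_coloring_classes :
  (#|coloring_classes M| * 2 ^ \rank (incidence G + face_incidence)%MS =
   2 ^ #|edge G|)%N.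
Proof.
have eqvM : {in [set: coloring G] & &, equivalence_rel (coloring_equiv M)}.
  by move=> x y z _ _ _; exact: coloring_equiv_rel.
have partM := equivalence_partitionP eqvM.
rewrite -card_rowg_F2 -(card_uniform_partition (n := #|rowg _|) _ partM).
  by rewrite cardsT card_ffun card_bool.
move=> _ /imsetP[c _ ->].
rewrite -(card_imset _ (bij_inj coloring_vec_bij)).
rewrite -(card_imset _ (addIr (- coloring_vec c))).
have [uncolor _ uncolorK] := coloring_vec_bij.
apply: eq_card => x; rewrite mem_rowg.
apply/imsetP/idP => [[_ /imsetP[c' + ->] ->] | xA].
  by rewrite inE in_setT coloring_equivE.
exists (x + coloring_vec c); last by rewrite addrK.
apply/imsetP; exists (uncolor (x + coloring_vec c)); last by rewrite uncolorK.
by rewrite inE in_setT coloring_equivE uncolorK addrK.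
Qed.

End Faces.

Theorem theorem4p1 (G : multigraph) (M : embedding G)
    (G_connected : connected G) (M_planar : planar M) :
  equivalence_rel (coloring_equiv M) /\
  `|(tutte_poly G).[-1, -1]| = #|coloring_classes M|%:Z.
Proof.
split; first exact: coloring_equiv_rel.
have two_neq0 n : 2 ^+ n != 0 :> int by rewrite expf_neq0.
apply: (mulIf (two_neq0 1)); rewrite expr1 normr_tutte //.
have classes := card_coloring_classes M.
rewrite rank_incidence_faces // in classes.
have rD := rank_incidence G_connected.
have := rank_leq_col (incidence G).
have := mxrankM_maxl (incidence G) (incidence G)^T.
set r := \rank (_ *m _) in classes *; set D := \rank _ in classes rD *.
move=> rD_le D_le.
(* Both sides are multiplied by the size of a class. As |V| = D + 1 and r <= D <= |E|, the exponents
   agree: (|V| - r) + (|E| - D + r) = |E| + 1. *)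
apply: (mulIf (two_neq0 (#|edge G| - D + r)%N)); rewrite -exprD mulrAC.
rewrite -natz -!natrX -!natrM classes -expnSr; congr (_ ^ _)%N%:R; lia.
Qed.
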